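(* Let $\Lambda$ and $\Gamma$ be artin algebras. If $\Lambda$ and $\Gamma$ are separably equivalent, then $\dim(\mathrm{mod}\,\Lambda)=\dim(\mathrm{mod}\,\Gamma)$.
   Context: $\mathrm{mod}\,\Lambda$ is the category of finitely generated right $\Lambda$-modules. Two artin algebras $\Lambda$ and $\Gamma$ are separably equivalent if there exist bimodules ${}_\Gamma M_\Lambda$ and ${}_\Lambda N_\Gamma$ such that: (1) $M$ and $N$ are both finitely generated projective as one-sided modules (on each side); (2) $M\otimes_\Lambda N\cong\Gamma\oplus X$ as $(\Gamma,\Gamma)$-bimodules for some bimodule ${}_\Gamma X_\Gamma$; (3) $N\otimes_\Gamma M\cong\Lambda\oplus Y$ as $(\Lambda,\Lambda)$-bimodules for some bimodule ${}_\Lambda Y_\Lambda$. Extension dimension: let $\mathcal{A}$ be an abelian category. For a class $\mathcal{U}$ of objects, $\mathrm{add}\,\mathcal{U}$ is the full subcategory of direct summands of finite direct sums of objects of $\mathcal{U}$. For subcategories $\mathcal{U}_1,\mathcal{U}_2$, $\mathcal{U}_1\diamond\mathcal{U}_2:=\mathrm{add}\{A\in\mathcal{A}\mid \text{there is an exact sequence } 0\to U_1\to A\to U_2\to 0 \text{ with } U_1\in\mathcal{U}_1, U_2\in\mathcal{U}_2\}$. For $T\in\mathcal{A}$: $\langle T\rangle_0=0$, $\langle T\rangle_1=\mathrm{add}\,T$, $\langle T\rangle_n=\langle T\rangle_1\diamond\langle T\rangle_{n-1}$ for $n\ge 2$. Then $\dim\mathcal{A}:=\inf\{n\ge 0\mid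 \mathcal{A}=\langle T\rangle_{n+1}\text{ for some }T\in\mathcal{A}\}$ (with $\inf\emptyset=+\infty$). *)

(* Defs.v *)
From HB Require Import structures.
From mathcomp Require Import all_boot all_order all_algebra.
From mathcomp Require Import generic_quotient ring_quotient.
From mathcomp Require Import boolp constructive_ereal.
From mathcomp.multinomials Require Import freeg.

Set Implicit Arguments.
Unset Strict Implicit.
Unset Printing Implicit Defensive.

Import GRing.Theory.
Local Open Scope ring_scope.
Local Open Scope quotient_scope.

(* Rings are [pzRingType]s, so that the zero algebra is not excluded.  A right
   L-module is a left module over the converse ring, i.e. an [lmodType L^c],
   with m . a written [a *: m]. *)

Definition fingen (R : pzRingType) (M : lmodType R) : Prop :=
  exists (n : nat) (x : 'I_n -> M),
    forall m : M, exists c : 'I_n -> R, m = \sum_(i < n) c i *: x i.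

Definition surj (A B : Type) (f : A -> B) : Prop :=
  forall b, exists a, f a = b.

Definition projective (R : pzRingType) (P : lmodType R) : Prop :=
  forall (U V : lmodType R) (g : {linear U -> V}) (f : {linear P -> V}),
    surj g -> exists h : {linear P -> U}, forall p, g (h p) = f p.

Definition fgprojective (R : pzRingType) (P : lmodType R) : Prop :=
  fingen P /\ projective P.

Definition lmod_iso (R : pzRingType) (M N : lmodType R) : Prop :=
  exists f : {linear M -> N}, bijective f.

Definition short_exact (R : pzRingType) (A B C : lmodType R) : Prop :=
  exists (f : {linear A -> B}) (g : {linear B -> C}),
    [/\ injective f, surj g & forall b, g b = 0 <-> exists a, f a = b].

Definition dsum (R : pzRingType) (M N : lmodType R) : lmodType R :=
  (M * N)%type.

Definition zero_mod (R : pzRingType) : lmodType R := 'rV[R]_0.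

Definition is_ideal (k : comPzRingType) (I : k -> Prop) : Prop :=
  [/\ I 0, forall x y, I x -> I y -> I (x + y) & forall a x, I x -> I (a * x)].

Definition artinian (k : comPzRingType) : Prop :=
  forall I : nat -> k -> Prop,
    (forall n, is_ideal (I n)) -> (forall n x, I n.+1 x -> I n x) ->
    exists n, forall m, (n <= m)%N -> forall x, I m x <-> I n x.

(* The algebra structure is given by a ring morphism to the center, because
   [algType] requires the algebra to be nontrivial. *)
Definition artin_algebra (L : pzRingType) : Prop :=
  exists (k : comPzRingType) (phi : {rmorphism k -> L}),
    [/\ artinian k,
        forall a x, phi a * x = x * phi a
      & exists (n : nat) (x : 'I_n -> L),
          forall y : L, exists c : 'I_n -> k, y = \sum_(i < n) phi (c i) * x i].

HB.mixin Record Lmodule_isBimodule (A B : pzRingType) M of GRing.Lmodule A M := {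
  ract : M -> B -> M;
  ractA : forall x b c, ract (ract x b) c = ract x (b * c);
  ract1 : forall x, ract x 1 = x;
  ractDl : forall x y b, ract (x + y) b = ract x b + ract y b;
  ractDr : forall x b c, ract x (b + c) = ract x b + ract x c;
  ractZ : forall a x b, ract (a *: x) b = a *: ract x b
}.

(* [bimodType A B] : A acts on the left, B on the right. *)
#[short(type="bimodType")]
HB.structure Definition Bimodule (A B : pzRingType) :=
  {M of GRing.Lmodule A M & Lmodule_isBimodule A B M}.

Definition bimod_iso (A B : pzRingType) (X Y : bimodType A B) : Prop :=
  exists f : {linear X -> Y},
    bijective f /\ forall (x : X) (b : B), f (ract x b) = ract (f x) b.

Definition rmod (A B : pzRingType) (M : bimodType A B) : Type := M.

Section RightModule.
Variables (A B : pzRingType) (M : bimodType A B).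
HB.instance Definition _ := GRing.Zmodule.on (rmod M).

Let rscale (b : B^c) (x : rmod M) : rmod M := ract (x : M) b.

Fact rmod_scaleA a b v : rscale a (rscale b v) = rscale (a * b) v.
Proof. exact: ractA. Qed.
Fact rmod_scale1 : left_id 1 rscale.
Proof. exact: ract1. Qed.
Fact rmod_scaleDr : right_distributive rscale +%R.
Proof. by move=> b x y; exact: ractDl. Qed.
Fact rmod_scaleDl v : {morph rscale^~ v : a b / a + b}.
Proof. by move=> a b; exact: ractDr. Qed.
HB.instance Definition _ := GRing.Zmodule_isLmodule.Build B^c (rmod M)
  rmod_scaleA rmod_scale1 rmod_scaleDr rmod_scaleDl.
End RightModule.

Section RegularBimodule.
Variable A : pzRingType.
Let mulA (x : A^o) (b : A) : A^o := (x : A) * b.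
Fact reg_ractA x b c : mulA (mulA x b) c = mulA x (b * c).
Proof. by rewrite /mulA mulrA. Qed.
Fact reg_ract1 x : mulA x 1 = x. Proof. exact: mulr1. Qed.
Fact reg_ractDl x y b : mulA (x + y) b = mulA x b + mulA y b.
Proof. exact: mulrDl. Qed.
Fact reg_ractDr x b c : mulA x (b + c) = mulA x b + mulA x c.
Proof. exact: mulrDr. Qed.
Fact reg_ractZ a x b : mulA (a *: x) b = a *: mulA x b.
Proof. by rewrite /mulA /GRing.scale /= mulrA. Qed.
HB.instance Definition _ := Lmodule_isBimodule.Build A A A^o
  reg_ractA reg_ract1 reg_ractDl reg_ractDr reg_ractZ.
End RegularBimodule.

Section PairBimodule.
Variables (A B : pzRingType) (X Y : bimodType A B).
Let pract (p : X * Y) (b : B) : X * Y := (ract p.1 b, ract p.2 b).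
Fact pair_ractA x b c : pract (pract x b) c = pract x (b * c).
Proof. by rewrite /pract /= !ractA. Qed.
Fact pair_ract1 x : pract x 1 = x.
Proof. by case: x => x y; rewrite /pract /= !ract1. Qed.
Fact pair_ractDl x y b : pract (x + y) b = pract x b + pract y b.
Proof. by rewrite /pract /= !ractDl. Qed.
Fact pair_ractDr x b c : pract x (b + c) = pract x b + pract x c.
Proof. by rewrite /pract /= !ractDr. Qed.
Fact pair_ractZ a x b : pract (a *: x) b = a *: pract x b.
Proof. by rewrite /pract /= !ractZ. Qed.
HB.instance Definition _ := Lmodule_isBimodule.Build A B (X * Y)%type
  pair_ractA pair_ract1 pair_ractDl pair_ractDr pair_ractZ.
End PairBimodule.

Definition bdsum (A B : pzRingType) (X Y : bimodType A B) : bimodType A B :=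
  (X * Y)%type.

(* [tensor M N]: the free abelian group on M * N modulo the subgroup
    generated by the biadditivity and balancing relations *)

Section Tensor.
Variables (B : pzRingType) (M : lmodType B^c) (N : lmodType B).
Local Notation F := {freeg (M * N)%type / int}.
Local Notation gen m n := (<< (m : M, n : N) >> : F).

Inductive tensor_relation : F -> Prop :=
| tensor_rel0 : tensor_relation 0
| tensor_relB x y :
    tensor_relation x -> tensor_relation y -> tensor_relation (x - y)
| tensor_relDl m m' n : tensor_relation (gen (m + m') n - gen m n - gen m' n)
| tensor_relDr m n n' : tensor_relation (gen m (n + n') - gen m n - gen m n')
| tensor_relZ m (b : B) n :
    tensor_relation (gen ((b : B^c) *: m) n - gen m (b *: n)).

Definition tensor_pred : F -> bool := fun x => `[< tensor_relation x >].

Fact tensor_pred_zmod_closed : zmod_closed tensor_pred.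
Proof.
split=> [|x y /asboolP rx /asboolP ry]; apply/asboolP; first exact: tensor_rel0.
exact: tensor_relB.
Qed.
HB.instance Definition _ :=
  GRing.isZmodClosed.Build F tensor_pred tensor_pred_zmod_closed.

Definition tensor_sub : zmodClosed F := GRing.ZmodClosed.clone F tensor_pred _.

Definition tensor : Type := Quotient.quot tensor_sub.
HB.instance Definition _ := GRing.Zmodule.on tensor.
HB.instance Definition _ :=
  ZmodQuotient.copy tensor (Quotient.quot tensor_sub).

Definition tens (m : M) (n : N) : tensor := \pi_tensor (gen m n).

Lemma tensor_relP x y :
  \pi_tensor x = \pi_tensor y <-> tensor_relation (x - y).
Proof.
split=> [/eqP|r]; first by rewrite -(Quotient.idealrBE tensor_sub) => /asboolP.
by apply/eqP; rewrite -(Quotient.idealrBE tensor_sub); apply/asboolP.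
Qed.

Lemma tensDl m m' n : tens (m + m') n = tens m n + tens m' n.
Proof.
rewrite /tens -raddfD; apply/tensor_relP; rewrite opprD addrA.
exact: tensor_relDl.
Qed.

Lemma tensDr m n n' : tens m (n + n') = tens m n + tens m n'.
Proof.
rewrite /tens -raddfD; apply/tensor_relP; rewrite opprD addrA.
exact: tensor_relDr.
Qed.

Lemma tensZ m (b : B) n : tens ((b : B^c) *: m) n = tens m (b *: n).
Proof. by apply/tensor_relP; exact: tensor_relZ. Qed.

Lemma tensor_ind (P : tensor -> Prop) :
  P 0 -> (forall x y, P x -> P y -> P (x - y)) -> (forall m n, P (tens m n)) ->
  forall t, P t.
Proof.
move=> P0 PB Pg t.
have PN x : P x -> P (- x) by move=> Px; rewrite -sub0r; exact: PB.
have PD x y : P x -> P y -> P (x + y).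
  by move=> Px /PN Py; rewrite -[y]opprK; exact: PB.
rewrite -[t]reprK -(freeg_sumE (repr t)) raddf_sum.
apply: (big_ind P) => // -[m n] _.
set k := coeff _ _.
have -> : << k *g (m, n) >> = gen m n *~ k by rewrite freeg_mulz intz.
rewrite raddfMz -/(tens m n).
have Pn j : P (tens m n *+ j).
  by elim: j => [|j IH]; rewrite ?mulr0n // mulrS; exact: PD.
by case: k => j; rewrite ?NegzE ?mulrNz -?pmulrn; [|apply: PN]; exact: Pn.
Qed.

Section Lift.
Variables (T : zmodType) (f : M -> N -> T).

(* The additive map tens m n |-> f m n, when f is biadditive and balanced. *)
Definition tensor_lift (t : tensor) : T :=
  fglift (fun p => f p.1 p.2 : zmodule T) (repr t).

Hypotheses (fDl : forall m m' n, f (m + m') n = f m n + f m' n)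
  (fDr : forall m n n', f m (n + n') = f m n + f m n')
  (fZ : forall m (b : B) n, f ((b : B^c) *: m) n = f m (b *: n)).

Lemma tensor_lift_pi x :
  tensor_lift (\pi_tensor x) = fglift (fun p => f p.1 p.2 : zmodule T) x.
Proof.
have /tensor_relP : \pi_tensor (repr (\pi_tensor x)) = \pi_tensor x.
  by rewrite reprK.
rewrite /tensor_lift; set L := fglift _; set y := repr _ => r.
have LB u v : L (u - v) = L u - L v by exact: lift_is_additive.
have LU m n : L << (m, n) >> = f m n by rewrite /L liftU scale1r.
apply/eqP; rewrite -subr_eq0 -LB; apply/eqP; elim: r => {x y}.
- by rewrite -[X in L X](subrr 0) LB subrr.
- by move=> x y _ Lx _ Ly; rewrite LB Lx Ly subrr.
- by move=> m m' n; rewrite !LB !LU fDl -addrA -opprD subrr.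
- by move=> m n n'; rewrite !LB !LU fDr -addrA -opprD subrr.
- by move=> m b n; rewrite !LB !LU fZ subrr.
Qed.

Lemma tensor_lift_tens m n : tensor_lift (tens m n) = f m n.
Proof. by rewrite tensor_lift_pi liftU scale1r. Qed.

Lemma tensor_lift_zmod_morphism : zmod_morphism tensor_lift.
Proof.
move=> x y; rewrite -[x]reprK -[y]reprK.
rewrite -raddfB !tensor_lift_pi.
exact: (lift_is_additive (M := zmodule T)).
Qed.
End Lift.
End Tensor.

Lemma tensor_eq (B : pzRingType) (M : lmodType B^c) (N : lmodType B)
    (T : zmodType) (g h : tensor M N -> T) :
  zmod_morphism g -> zmod_morphism h ->
  (forall m n, g (tens m n) = h (tens m n)) -> g =1 h.
Proof.
move=> gB hB gh; elim/tensor_ind=> //.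
- by rewrite -(subrr 0) gB hB !subrr.
- by move=> x y gx gy; rewrite gB hB gx gy.
Qed.

Definition btensor (A B C : pzRingType) (X : bimodType A B)
  (Y : bimodType B C) : Type := tensor (rmod X) Y.

Section BimoduleTensor.
Variables (A B C : pzRingType) (X : bimodType A B) (Y : bimodType B C).
Local Notation T := (btensor X Y).
HB.instance Definition _ := GRing.Zmodule.on T.

Definition btens (x : X) (y : Y) : T := tens (x : rmod X) y.

Definition btensor_scale (a : A) (t : T) : T :=
  tensor_lift (fun (x : rmod X) (y : Y) => btens (a *: (x : X)) y) t.

Definition btensor_ract (t : T) (c : C) : T :=
  tensor_lift (fun (x : rmod X) (y : Y) => btens x (ract y c)) t.

Fact btensor_scale_tens a x y : btensor_scale a (btens x y) = btens (a *: x) y.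
Proof.
apply: tensor_lift_tens => [m m' n|m n n'|m b n].
- by rewrite [a *: _]scalerDr; exact: tensDl.
- exact: tensDr.
- by rewrite -[a *: _]ractZ; exact: tensZ.
Qed.

Fact btensor_scale_additive a : zmod_morphism (btensor_scale a).
Proof.
apply: tensor_lift_zmod_morphism => [m m' n|m n n'|m b n].
- by rewrite [a *: _]scalerDr; exact: tensDl.
- exact: tensDr.
- by rewrite -[a *: _]ractZ; exact: tensZ.
Qed.

Fact btensor_ract_tens x y c : btensor_ract (btens x y) c = btens x (ract y c).
Proof.
apply: tensor_lift_tens => [m m' n|m n n'|m b n].
- exact: tensDl.
- by rewrite ractDl; exact: tensDr.
- by rewrite ractZ; exact: tensZ.
Qed.

Fact btensor_ract_additive c : zmod_morphism (btensor_ract^~ c).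
Proof.
apply: tensor_lift_zmod_morphism => [m m' n|m n n'|m b n].
- exact: tensDl.
- by rewrite ractDl; exact: tensDr.
- by rewrite ractZ; exact: tensZ.
Qed.

Let subZ a t u : btensor_scale a (t - u) = btensor_scale a t - btensor_scale a u.
Proof. exact: btensor_scale_additive. Qed.
Let subR c t u : btensor_ract (t - u) c = btensor_ract t c - btensor_ract u c.
Proof. exact: (btensor_ract_additive c). Qed.

Lemma btensor_eq (D : zmodType) (g h : T -> D) :
  zmod_morphism g -> zmod_morphism h ->
  (forall x y, g (btens x y) = h (btens x y)) -> g =1 h.
Proof. exact: tensor_eq. Qed.

Fact btensor_scaleA a b t :
  btensor_scale a (btensor_scale b t) = btensor_scale (a * b) t.
Proof.
apply: (btensor_eq (g := btensor_scale a \o btensor_scale b)) t => [t u|t u|x y].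
- by rewrite /= !subZ.
- exact: subZ.
- by rewrite /= !btensor_scale_tens scalerA.
Qed.

Fact btensor_scale1 : left_id 1 btensor_scale.
Proof.
move=> t; apply: (btensor_eq (g := btensor_scale 1) (h := id)) t => [t u|t u|x y] //.
by rewrite btensor_scale_tens scale1r.
Qed.

Fact btensor_scaleDr : right_distributive btensor_scale +%R.
Proof.
move=> a t u.
have NZ v : btensor_scale a (- v) = - btensor_scale a v.
  by rewrite -[- v]sub0r -[X in X - v](subrr v) subZ subZ subrr sub0r.
by rewrite -{1}[u]opprK subZ NZ opprK.
Qed.

Fact btensor_scaleDl t : {morph btensor_scale^~ t : a b / a + b}.
Proof.
move=> a b /=.
apply: (btensor_eq (g := btensor_scale (a + b))
  (h := fun t => btensor_scale a t + btensor_scale b t)) t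
  => [t u|t u|x y].
- exact: subZ.
- by rewrite !subZ opprD addrACA.
- by rewrite !btensor_scale_tens scalerDl; exact: tensDl.
Qed.

HB.instance Definition _ := GRing.Zmodule_isLmodule.Build A T
  btensor_scaleA btensor_scale1 btensor_scaleDr btensor_scaleDl.

Fact btensor_ractA t b c :
  btensor_ract (btensor_ract t b) c = btensor_ract t (b * c).
Proof.
apply: (btensor_eq (g := btensor_ract^~ c \o btensor_ract^~ b)
  (h := btensor_ract^~ (b * c))) t => [t u|t u|x y].
- by rewrite /= !subR.
- exact: subR.
- by rewrite /= !btensor_ract_tens ractA.
Qed.

Fact btensor_ract1 t : btensor_ract t 1 = t.
Proof.
apply: (btensor_eq (g := btensor_ract^~ 1) (h := id)) t => [t u|t u|x y] //.
by rewrite btensor_ract_tens ract1.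
Qed.

Fact btensor_ractDl t u c :
  btensor_ract (t + u) c = btensor_ract t c + btensor_ract u c.
Proof.
have NR v : btensor_ract (- v) c = - btensor_ract v c.
  by rewrite -[- v]sub0r -[X in X - v](subrr v) subR subR subrr sub0r.
by rewrite -{1}[u]opprK subR NR opprK.
Qed.

Fact btensor_ractDr t b c :
  btensor_ract t (b + c) = btensor_ract t b + btensor_ract t c.
Proof.
apply: (btensor_eq (g := btensor_ract^~ (b + c))
  (h := fun t => btensor_ract t b + btensor_ract t c)) t => [t u|t u|x y].
- exact: subR.
- by rewrite !subR opprD addrACA.
- by rewrite !btensor_ract_tens ractDr; exact: tensDr.
Qed.

Fact btensor_ractZ (a : A) (t : T) c :
  btensor_ract (a *: t) c = a *: btensor_ract t c.
Proof.
apply: (btensor_eq (g := btensor_ract^~ c \o btensor_scale a)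
  (h := btensor_scale a \o btensor_ract^~ c)) t => [t u|t u|x y].
- by rewrite /= subZ subR.
- by rewrite /= subR subZ.
- by rewrite /= !(btensor_scale_tens, btensor_ract_tens).
Qed.

HB.instance Definition _ := Lmodule_isBimodule.Build A C T
  btensor_ractA btensor_ract1 btensor_ractDl btensor_ractDr btensor_ractZ.

Lemma btensZ (a : A) x y : a *: btens x y = btens (a *: x) y.
Proof. exact: btensor_scale_tens. Qed.

Lemma btens_ract x y (c : C) : ract (btens x y) c = btens x (ract y c).
Proof. exact: btensor_ract_tens. Qed.
End BimoduleTensor.

Definition separably_equivalent (L G : pzRingType) : Prop :=
  exists (M : bimodType G L) (N : bimodType L G),
    [/\ [/\ fgprojective M, fgprojective (rmod M),
            fgprojective N & fgprojective (rmod N)],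
        exists X : bimodType G G, bimod_iso (btensor M N) (bdsum G^o X)
      & exists Y : bimodType L L, bimod_iso (btensor N M) (bdsum L^o Y)].

Record fgmod (R : pzRingType) : Type := FGMod {
  fgmod_sort :> lmodType R;
  fgmodP : fingen fgmod_sort
}.

(* A full subcategory of the finitely generated modules, given by its class of
   objects. *)
Definition mod_class (R : pzRingType) : Type := fgmod R -> Prop.

Section ExtensionDimension.
Variable R : pzRingType.
Implicit Types (U : mod_class R) (T A : fgmod R).

Definition add_class U : mod_class R := fun A =>
  exists (n : nat) (X : 'I_n -> fgmod R) (B : fgmod R),
    (forall i, U (X i)) /\
    lmod_iso (dsum A B)
      (\big[@dsum R/zero_mod R]_(i < n) (X i : lmodType R)).

Definition diamond U1 U2 : mod_class R :=
  add_class (fun A => exists X1 X2 : fgmod R,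
    [/\ U1 X1, U2 X2 & short_exact X1 A X2]).

Fixpoint angle T (n : nat) : mod_class R :=
  match n with
  | 0 => fun A => forall x : A, x = 0
  | 1 => add_class (fun A => A = T)
  | n'.+1 => diamond (add_class (fun A => A = T)) (angle T n')
  end.

Definition ext_dim_le (n : nat) : Prop :=
  exists T, forall A, angle T n.+1 A.

(* The infimum of a set of naturals in nat + {+oo}. *)
Definition ext_dim : \bar nat :=
  match pselect (exists n, `[< ext_dim_le n >]) with
  | left ex_n => (ex_minn ex_n)%:E
  | right _ => +oo%E
  end.
End ExtensionDimension.

Definition dim_mod (L : pzRingType) : \bar nat := ext_dim L^c.

(* Main.v *)
Require Import Defs.
From mathcomp Require Import all_boot all_order all_algebra.
From HB Require Import structures.
From mathcomp Require Import boolp constructive_ereal.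

Set Implicit Arguments.
Unset Strict Implicit.
Unset Printing Implicit Defensive.

Import GRing.Theory.
Local Open Scope ring_scope.

(** Let F = - (x) N : mod L -> mod G and F' = - (x) M : mod G -> mod L be the
functors given by the two bimodules.  They preserve finite generation because N
and M are finitely generated on the right, and they are exact because N and M
are finitely generated projective on the left.  An exact additive functor maps
add T to add (F T) and extensions to extensions, so it maps <T>_n into
<F T>_n ([fgtensor_angle]).

Any right G-module B is a direct summand of F (F' B) = (B (x) M) (x) N
([separable_retract]).  Hence, if <T>_{n+1} is all of mod L, then F (F' B) lies
in <F T>_{n+1}, which is closed under direct summands, and so does B: this gives
dim (mod G) <= dim (mod L), and the reverse inequality follows by symmetry.

Three choices keep the argument elementary.
- Membership in add U is handled as being a retract of a finite direct sum of
  objects of U ([add_classP]): retracts are visibly preserved by functors and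
  transitive, whereas a complement has to be produced only once, as the kernel
  of the retraction.
- Exactness of F does not go through general flatness.  A dual basis
  (x_i, phi_i) of N gives t = sum_i (phi_i t) (x) x_i for t in A (x) N
  ([contract_expand]), where phi_i contracts A (x) N to A naturally in A; so
  injectivity and exactness in the middle can be read off coordinates.
- The retraction of (B (x) M) (x) N onto B is written down directly from a
  bimodule map p : M (x) N -> G and an element e of M (x) N commuting with G
  such that p e = 1, so that no associativity isomorphism is involved. *)

(** * Finitely generated modules *)

(** Coordinates over an arbitrary finite index type, so that generators of sums
and tensor products can be indexed by sums and products of index types. *)
Section Spans.
Variables (R : pzRingType) (M : lmodType R) (I : finType) (x : I -> M).

Definition spanned (m : M) : Prop := exists c : I -> R, m = \sum_i c i *: x i.

Lemma spanned0 : spanned 0.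
Proof. by exists (fun=> 0); rewrite big1 // => i _; rewrite scale0r. Qed.

Lemma spannedD m m' : spanned m -> spanned m' -> spanned (m + m').
Proof.
move=> [c ->] [c' ->]; exists (fun i => c i + c' i); rewrite -big_split /=.
by apply: eq_bigr => i _; rewrite scalerDl.
Qed.

Lemma spannedN m : spanned m -> spanned (- m).
Proof.
move=> [c ->]; exists (fun i => - c i); rewrite -sumrN.
by apply: eq_bigr => i _; rewrite scaleNr.
Qed.

Lemma spanned_gen a i : spanned (a *: x i).
Proof.
exists (fun j => if j == i then a else 0).
rewrite (bigD1 i) //= eqxx big1 ?addr0 // => j /negPf ->.
by rewrite scale0r.
Qed.

Lemma spanned_sum (J : finType) (m : J -> M) :
  (forall j, spanned (m j)) -> spanned (\sum_j m j).
Proof.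
by move=> sp; apply: big_ind => // [|u v]; [exact: spanned0|exact: spannedD].
Qed.

Lemma spanned_fingen : (forall m, spanned m) -> fingen M.
Proof.
move=> sp; exists #|I|, (fun k => x (enum_val k)) => m.
have [c ->] := sp m; exists (fun k => c (enum_val k)).
by rewrite -(big_enum_val (fun i => c i *: x i)).
Qed.
End Spans.

Lemma fingen_surj (R : pzRingType) (M N : lmodType R) (f : {linear M -> N}) :
  surj f -> fingen M -> fingen N.
Proof.
move=> fS [n [x sp]]; exists n, (f \o x) => b.
have [a <-] := fS b; have [c ->] := sp a; exists c.
by rewrite linear_sum; apply: eq_bigr => i _; rewrite linearZ.
Qed.

Lemma fingen_dsum (R : pzRingType) (M N : lmodType R) :
  fingen M -> fingen N -> fingen (dsum M N).
Proof.
move=> [m [x spx]] [n [y spy]].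
pose z (k : 'I_m + 'I_n) : dsum M N :=
  match k with inl i => (x i, 0) | inr j => (0, y j) end.
apply: (@spanned_fingen R _ _ z) => -[a b].
have [c ea] := spx a; have [d eb] := spy b.
have -> : (a, b) = (\sum_i c i *: z (inl i)) + \sum_j d j *: z (inr j).
  rewrite [RHS]surjective_pairing; congr pair.
    rewrite [RHS](raddfD fst) !(raddf_sum fst) /= ea.
    by rewrite [X in _ + X]big1 ?addr0 // => j _; rewrite scaler0.
  rewrite [RHS](raddfD snd) !(raddf_sum snd) /= eb.
  by rewrite [X in X + _]big1 ?add0r // => i _; rewrite scaler0.
apply: spannedD; apply: spanned_sum => k; exact: spanned_gen.
Qed.

Lemma fingen_zero (R : pzRingType) : fingen (zero_mod R).
Proof.
exists 0, (fun=> 0) => m; exists (fun=> 0); rewrite big_ord0.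
by apply/matrixP => i [].
Qed.

Lemma fingen_bigdsum (R : pzRingType) n (X : 'I_n -> lmodType R) :
  (forall i, fingen (X i)) -> fingen (\big[@dsum R/zero_mod R]_(i < n) X i).
Proof.
elim: n X => [|n IH] X fgX; first by rewrite big_ord0; exact: fingen_zero.
by rewrite big_ord_recl; apply: fingen_dsum => //; apply: IH.
Qed.

(** * Retracts and additive closures *)

Definition retract (R : pzRingType) (A S : lmodType R) : Prop :=
  exists (i : {linear A -> S}) (r : {linear S -> A}), cancel i r.

Lemma retract_trans (R : pzRingType) (A B C : lmodType R) :
  retract A B -> retract B C -> retract A C.
Proof.
move=> [i [r ir]] [j [s js]]; exists (j \o i), (r \o s).
by move=> a /=; rewrite js ir.
Qed.

Section Biproduct.
Variables (R : pzRingType) (A B : lmodType R).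

Definition dinl (a : A) : dsum A B := (a, 0).
Fact dinl_linear : linear dinl.
Proof. by move=> c a b; congr pair; rewrite /= scaler0 addr0. Qed.
HB.instance Definition _ :=
  GRing.isLinear.Build R A (dsum A B) *:%R dinl dinl_linear.

Definition dinr (b : B) : dsum A B := (0, b).
Fact dinr_linear : linear dinr.
Proof. by move=> c a b; congr pair; rewrite /= scaler0 addr0. Qed.
HB.instance Definition _ :=
  GRing.isLinear.Build R B (dsum A B) *:%R dinr dinr_linear.

Definition dfst : dsum A B -> A := fst.
HB.instance Definition _ := GRing.Linear.on dfst.
Definition dsnd : dsum A B -> B := snd.
HB.instance Definition _ := GRing.Linear.on dsnd.

Lemma dsumE p : dinl (dfst p) + dinr (dsnd p) = p.
Proof. by case: p => a b; congr pair; rewrite /= ?addr0 ?add0r. Qed.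

Section Pairing.
Variables (C : lmodType R) (f : {linear C -> A}) (g : {linear C -> B}).
Definition dpair (c : C) : dsum A B := (f c, g c).
Fact dpair_linear : linear dpair.
Proof. by move=> c a b; congr pair; rewrite linearP. Qed.
HB.instance Definition _ :=
  GRing.isLinear.Build R C (dsum A B) *:%R dpair dpair_linear.
End Pairing.

Section Copairing.
Variables (C : lmodType R) (f : {linear A -> C}) (g : {linear B -> C}).
Definition dcopair (p : dsum A B) : C := f (dfst p) + g (dsnd p).
Fact dcopair_linear : linear dcopair.
Proof.
by move=> c a b; rewrite /dcopair !linearP scalerDr addrACA.
Qed.
HB.instance Definition _ :=
  GRing.isLinear.Build R (dsum A B) C *:%R dcopair dcopair_linear.
End Copairing.
End Biproduct.

Lemma retract_dsum (R : pzRingType) (A A' B B' : lmodType R) :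
  retract A A' -> retract B B' -> retract (dsum A B) (dsum A' B').
Proof.
move=> [i [r ir]] [j [s js]].
exists (dpair (i \o @dfst R A B) (j \o @dsnd R A B)).
exists (dpair (r \o @dfst R A' B') (s \o @dsnd R A' B')).
by case=> a b; congr pair; [exact: ir|exact: js].
Qed.

Lemma linear_inverse (R : pzRingType) (A B : lmodType R) (f : {linear A -> B}) :
  bijective f -> exists g : {linear B -> A}, cancel f g /\ cancel g f.
Proof.
move=> [g fK gK].
have gL : linear g by move=> c a b; apply: (can_inj fK); rewrite linearP !gK.
pose G : {linear B -> A} := HB.pack g (GRing.isLinear.Build R B A *:%R g gL).
by exists G.
Qed.

Lemma dsum_iso_retract (R : pzRingType) (A B S : lmodType R) :
  lmod_iso (dsum A B) S -> retract A S.
Proof.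
move=> [f /linear_inverse[g [fK _]]].
by exists (f \o @dinl R A B), (@dfst R A B \o g) => a /=; rewrite fK.
Qed.

Section Kernel.
Variables (R : pzRingType) (U V : lmodType R) (f : {linear U -> V}).

Definition kernel_pred : {pred U} := fun u => f u == 0.
Fact kernel_pred_closed : submod_closed kernel_pred.
Proof.
split=> [|a u v]; rewrite ?unfold_in /kernel_pred ?linear0 ?linearP // => /eqP->.
by move/eqP=> ->; rewrite scaler0 addr0.
Qed.
HB.instance Definition _ :=
  GRing.isSubmodClosed.Build R U kernel_pred kernel_pred_closed.

Record kernel :=
  Kernel { kernel_val : U; kernel_valP : kernel_val \in kernel_pred }.
HB.instance Definition _ := [isSub for kernel_val].
HB.instance Definition _ := [Choice of kernel by <:].
HB.instance Definition _ := [SubChoice_isSubLmodule of kernel by <:].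

Lemma kernelP (k : kernel) : f (val k) = 0.
Proof. exact/eqP/(kernel_valP k). Qed.
End Kernel.

Section Complement.
Variables (R : pzRingType) (A S : lmodType R).
Variables (i : {linear A -> S}) (r : {linear S -> A}) (ir : cancel i r).

Let coproj_subproof s : s - i (r s) \in kernel_pred r.
Proof. by rewrite unfold_in /kernel_pred linearB /= ir subrr. Qed.

Definition coproj (s : S) : kernel r := Kernel (coproj_subproof s).
Fact coproj_linear : linear coproj.
Proof.
move=> c s t; apply: val_inj; rewrite /= !linearP /= scalerBr.
by rewrite scalerN addrACA.
Qed.
HB.instance Definition _ :=
  GRing.isLinear.Build R S (kernel r) *:%R coproj coproj_linear.

Lemma retract_complement : lmod_iso (dsum A (kernel r)) S.
Proof.
exists (dcopair i (val : {linear kernel r -> S})).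
exists (dpair r coproj) => [[a k]|s]; rewrite /dpair /dcopair /=.
  have rk : r (i a + val k) = a by rewrite linearD kernelP addr0 /= ir.
  by congr pair => //; apply: val_inj; rewrite /= rk addrC addKr.
by rewrite /dcopair /= addrC subrK.
Qed.

Lemma coproj_surj : surj coproj.
Proof.
by move=> k; exists (val k); apply: val_inj; rewrite /= kernelP linear0 subr0.
Qed.
End Complement.

(** The complement is the kernel of the retraction; it is a quotient of [S] by
[s |-> s - i (r s)], which is why it inherits finite generation. *)
Lemma retract_fingen_complement (R : pzRingType) (A S : lmodType R) :
  retract A S -> fingen S -> exists B : fgmod R, lmod_iso (dsum A B) S.
Proof.
move=> [i [r ir]] fgS.
exists (FGMod (fingen_surj (coproj_surj ir) fgS)).
exact: retract_complement.
Qed.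

(** Every retraction of finitely generated modules splits.  In this form the
additive closure can be transported by functors. *)
Lemma add_classP (R : pzRingType) (U : mod_class R) (A : fgmod R) :
  add_class U A <->
  exists (n : nat) (X : 'I_n -> fgmod R), (forall i, U (X i)) /\
    retract A (\big[@dsum R/zero_mod R]_(i < n) (X i : lmodType R)).
Proof.
split=> [[n [X [B [UX /dsum_iso_retract rA]]]]|[n [X [UX rA]]]]; exists n, X => //.
have [|B isoB] := retract_fingen_complement rA; last by exists B.
by apply: fingen_bigdsum => i; exact: fgmodP.
Qed.

Lemma add_class_retract (R : pzRingType) (U : mod_class R) (A B : fgmod R) :
  retract A B -> add_class U B -> add_class U A.
Proof.
move=> rAB /add_classP[n [X [UX rB]]]; apply/add_classP; exists n, X.
by split=> //; exact: retract_trans rB.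
Qed.

Lemma angle_retract (R : pzRingType) (T : fgmod R) n (A B : fgmod R) :
  retract A B -> angle T n.+1 B -> angle T n.+1 A.
Proof. by case: n => [|n]; exact: add_class_retract. Qed.

(** * Tensoring with a bimodule *)

Section TensorMap.
Variables (B : pzRingType) (M M' : lmodType B^c) (N N' : lmodType B).
Variables (f : {linear M -> M'}) (g : {linear N -> N'}).

Definition tensor_map : tensor M N -> tensor M' N' :=
  tensor_lift (fun m n => tens (f m) (g n)).

Let tDl m m' n : tens (f (m + m')) (g n) = tens (f m) (g n) + tens (f m') (g n).
Proof. by rewrite raddfD tensDl. Qed.
Let tDr m n n' : tens (f m) (g (n + n')) = tens (f m) (g n) + tens (f m) (g n').
Proof. by rewrite raddfD tensDr. Qed.
Let tZ m (b : B) n : tens (f ((b : B^c) *: m)) (g n) = tens (f m) (g (b *: n)).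
Proof. by rewrite !linearZ /= tensZ. Qed.

Lemma tensor_map_tens m n : tensor_map (tens m n) = tens (f m) (g n).
Proof. exact: tensor_lift_tens. Qed.

Fact tensor_map_zmod_morphism : zmod_morphism tensor_map.
Proof. exact: tensor_lift_zmod_morphism. Qed.
HB.instance Definition _ :=
  GRing.isZmodMorphism.Build (tensor M N) (tensor M' N') tensor_map
    tensor_map_zmod_morphism.
End TensorMap.

Lemma tensor_ext (B : pzRingType) (M : lmodType B^c) (N : lmodType B)
    (T : zmodType) (g h : {additive tensor M N -> T}) :
  (forall m n, g (tens m n) = h (tens m n)) -> g =1 h.
Proof. by apply: tensor_eq; exact: raddfB. Qed.

Section RightMultiplication.
Variables (A B : pzRingType) (N : bimodType A B) (b : B).

Definition ract_by (x : N) : N := ract x b.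

Fact ract_by_linear : linear ract_by.
Proof. by move=> a x y; rewrite /ract_by ractDl ractZ. Qed.
HB.instance Definition _ :=
  GRing.isLinear.Build A N N *:%R ract_by ract_by_linear.
End RightMultiplication.

(** A copy of [tensor A N] that remembers the right action on [N], so that it
can carry the structure of a right [G]-module. *)
Definition rtensor (L G : pzRingType) (A : lmodType L^c) (N : bimodType L G) :
  Type := tensor A N.

Section RightTensor.
Variables (L G : pzRingType) (A : lmodType L^c) (N : bimodType L G).
HB.instance Definition _ := GRing.Zmodule.on (rtensor A N).

Definition rtens (a : A) (n : N) : rtensor A N := tens a n.

Let rscale (c : G^c) : rtensor A N -> rtensor A N :=
  tensor_map (idfun : {linear A -> A}) (ract_by (c : G)).

Fact rtensor_scaleA a b v : rscale a (rscale b v) = rscale (a * b) v.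
Proof.
apply: (tensor_ext (g := rscale a \o rscale b)) v => m n /=.
by rewrite /rscale !tensor_map_tens /= /ract_by ractA.
Qed.

Fact rtensor_scale1 : left_id 1 rscale.
Proof.
apply: (tensor_ext (g := rscale 1) (h := idfun)) => m n.
by rewrite [LHS]tensor_map_tens /= /ract_by ract1.
Qed.

Fact rtensor_scaleDr : right_distributive rscale +%R.
Proof. by move=> b x y; exact: raddfD. Qed.

Fact rtensor_scaleDl v : {morph rscale^~ v : a b / a + b}.
Proof.
move=> a b.
apply: (tensor_ext (g := rscale (a + b)) (h := rscale a \+ rscale b)) v => m n.
by rewrite /= /rscale !tensor_map_tens /= /ract_by ractDr tensDr.
Qed.

HB.instance Definition _ := GRing.Zmodule_isLmodule.Build G^c (rtensor A N)
  rtensor_scaleA rtensor_scale1 rtensor_scaleDr rtensor_scaleDl.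

Lemma rtensZ (c : G) a n : (c : G^c) *: rtens a n = rtens a (ract n c).
Proof. exact: tensor_map_tens. Qed.
End RightTensor.

Lemma rtens_balanced (L G : pzRingType) (A : lmodType L^c) (N : bimodType L G)
    (l : L) (a : A) (n : N) :
  rtens ((l : L^c) *: a) n = rtens a (l *: n).
Proof. exact: tensZ. Qed.

Lemma rtensor_ext (L G : pzRingType) (A : lmodType L^c) (N : bimodType L G)
    (T : zmodType) (g h : {additive rtensor A N -> T}) :
  (forall a n, g (rtens a n) = h (rtens a n)) -> g =1 h.
Proof. by apply: tensor_eq; exact: raddfB. Qed.

Section RightTensorSums.
Variables (L G : pzRingType) (A : lmodType L^c) (N : bimodType L G).

(** [rtens] with its arguments swapped, so that additivity in the left factor is
that of a partial application. *)
Definition rtensl (n : N) (a : A) : rtensor A N := rtens a n.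

Fact rtensl_zmod_morphism n : zmod_morphism (rtensl n).
Proof.
by move=> a b; apply: (addIr (rtensl n b)); rewrite subrK -[LHS]tensDl subrK.
Qed.
HB.instance Definition _ n :=
  GRing.isZmodMorphism.Build A (rtensor A N) (rtensl n) (rtensl_zmod_morphism n).

Fact rtens_zmod_morphism a : zmod_morphism (@rtens L G A N a).
Proof.
by move=> m n; apply: (addIr (rtens a n)); rewrite subrK -[LHS]tensDr subrK.
Qed.
HB.instance Definition _ a :=
  GRing.isZmodMorphism.Build N (rtensor A N) (rtens a) (rtens_zmod_morphism a).

Lemma rtens0l n : rtens (0 : A) (n : N) = 0.
Proof. exact: (raddf0 (rtensl n)). Qed.

Lemma rtensBl (a a' : A) (n : N) : rtens (a - a') n = rtens a n - rtens a' n.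
Proof. exact: (raddfB (rtensl n)). Qed.

Lemma rtens_suml I (r : seq I) (a : I -> A) (n : N) :
  rtens (\sum_(i <- r) a i) n = \sum_(i <- r) rtens (a i) n.
Proof. exact: (raddf_sum (rtensl n)). Qed.

Lemma rtens_sumr I (r : seq I) (a : A) (n : I -> N) :
  rtens a (\sum_(i <- r) n i) = \sum_(i <- r) rtens a (n i).
Proof. exact: raddf_sum. Qed.
End RightTensorSums.

Section RightTensorMap.
Variables (L G : pzRingType) (A A' : lmodType L^c) (N : bimodType L G).
Variable f : {linear A -> A'}.

Definition rtensor_map : rtensor A N -> rtensor A' N :=
  tensor_map f (idfun : {linear N -> N}).

Lemma rtensor_map_tens a n : rtensor_map (rtens a n) = rtens (f a) n.
Proof. exact: tensor_map_tens. Qed.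

Fact rtensor_map_zmod_morphism : zmod_morphism rtensor_map.
Proof. exact: tensor_map_zmod_morphism. Qed.
HB.instance Definition _ :=
  GRing.isZmodMorphism.Build (rtensor A N) (rtensor A' N) rtensor_map
    rtensor_map_zmod_morphism.

Fact rtensor_map_scalable : scalable rtensor_map.
Proof.
move=> c.
apply: (rtensor_ext (g := rtensor_map \o *:%R c) (h := *:%R c \o rtensor_map)).
by move=> a n; rewrite /= rtensZ !rtensor_map_tens rtensZ.
Qed.
HB.instance Definition _ :=
  GRing.isScalable.Build G^c (rtensor A N) (rtensor A' N) *:%R rtensor_map
    rtensor_map_scalable.
End RightTensorMap.

(** The products of generators generate, since scalars coming from [A] can be
moved onto [N], and [N] is generated by the [y j] under the action of [G]. *)
Lemma fingen_rtensor (L G : pzRingType) (A : lmodType L^c) (N : bimodType L G) :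
  fingen A -> fingen (rmod N) -> fingen (rtensor A N).
Proof.
move=> [m [x spx]] [n [y spy]].
pose z (k : 'I_m * 'I_n) : rtensor A N := rtens (x k.1) (y k.2).
apply: (@spanned_fingen G^c _ _ z); apply: tensor_ind => [|t u st su|a b].
- exact: spanned0.
- by apply: spannedD => //; apply: spannedN.
have [c ->] := spx a.
have -> : tens (\sum_i c i *: x i) b = \sum_i rtens (x i) ((c i : L) *: b).
  rewrite -[LHS]/(rtens _ b) rtens_suml.
  by apply: eq_bigr => i _; exact: rtens_balanced.
apply: spanned_sum => i; have [d ->] := spy ((c i : L) *: b : rmod N).
rewrite rtens_sumr; apply: spanned_sum => j.
rewrite -[rtens _ _]/(rtens (x i) (ract (y j : N) (d j : G))) -rtensZ.
exact: (spanned_gen z (d j) (i, j)).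
Qed.

(** * Exactness of the tensor functor *)

(** A section of the surjection from the free module on the generators has the
functionals [phi i] as its coordinates. *)
Lemma dual_basis (R : pzRingType) (P : lmodType R) : fgprojective P ->
  exists (n : nat) (x : 'I_n -> P) (phi : 'I_n -> {linear P -> R^o}),
    forall p, p = \sum_i (phi i p : R) *: x i.
Proof.
move=> [[n [x spx]] projP]; exists n, x.
pose g (v : 'rV[R]_n) := \sum_i v 0 i *: x i.
have gL : linear g.
  move=> c u v; rewrite /g scaler_sumr -big_split; apply: eq_bigr => i _ /=.
  by rewrite !mxE scalerDl scalerA.
pose gl : {linear 'rV[R]_n -> P} :=
  HB.pack g (GRing.isLinear.Build R 'rV[R]_n P *:%R g gL).
have gS : surj gl.
  move=> p; have [c ->] := spx p; exists (\row_i c i).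
  by apply: eq_bigr => i _; rewrite mxE.
have [h hP] := projP _ _ gl (idfun : {linear P -> P}) gS.
have phiL i : linear (fun p => h p 0 i : R^o).
  by move=> c p q; rewrite linearP !mxE.
pose phi i : {linear P -> R^o} :=
  HB.pack (fun p => h p 0 i : R^o) (GRing.isLinear.Build R P R^o *:%R _ (phiL i)).
by exists phi => p; rewrite -{1}[p]hP.
Qed.

(** A functional on [N] contracts a tensor in [A (x) N] to an element of [A].
Naturality in [A] is what lets exactness be checked on contractions. *)
Section Contraction.
Variables (L G : pzRingType) (N : bimodType L G) (phi : {linear N -> L^o}).

Definition contract (A : lmodType L^c) : rtensor A N -> A :=
  tensor_lift (fun (a : A) n => (phi n : L^c) *: a).

Section ContractionAt.
Variable A : lmodType L^c.

Let cDl (a a' : A) n :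
  (phi n : L^c) *: (a + a') = (phi n : L^c) *: a + (phi n : L^c) *: a'.
Proof. exact: scalerDr. Qed.
Let cDr (a : A) n n' :
  (phi (n + n') : L^c) *: a = (phi n : L^c) *: a + (phi n' : L^c) *: a.
Proof. by rewrite raddfD -scalerDl. Qed.
Let cZ (a : A) (b : L) n :
  (phi n : L^c) *: ((b : L^c) *: a) = (phi (b *: n) : L^c) *: a.
Proof. by rewrite linearZ scalerA. Qed.

Lemma contract_tens a n : @contract A (rtens a n) = (phi n : L^c) *: a.
Proof. exact: tensor_lift_tens. Qed.

Fact contract_zmod_morphism : zmod_morphism (@contract A).
Proof. exact: tensor_lift_zmod_morphism. Qed.
HB.instance Definition _ :=
  GRing.isZmodMorphism.Build (rtensor A N) A (@contract A) contract_zmod_morphism.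
End ContractionAt.

Lemma contract_natural (A A' : lmodType L^c) (f : {linear A -> A'}) t :
  contract (rtensor_map f t) = f (contract t).
Proof.
apply: (rtensor_ext (g := @contract A' \o rtensor_map f) (h := f \o @contract A)).
by move=> a n /=; rewrite rtensor_map_tens !contract_tens linearZ.
Qed.
End Contraction.

(** The dual basis embeds [A (x) N] in a finite power of [A] by the contractions,
with [(a_i) |-> sum_i a_i (x) x_i] as a left inverse. *)
Lemma contract_expand (L G : pzRingType) (N : bimodType L G) n (x : 'I_n -> N)
    (phi : 'I_n -> {linear N -> L^o}) :
  (forall p, p = \sum_i (phi i p : L) *: x i) ->
  forall (A : lmodType L^c) (t : rtensor A N),
    t = \sum_i rtens (contract (phi i) t) (x i).
Proof.
move=> dual A; apply: tensor_ind => [|t u et eu|a p].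
- by rewrite big1 // => i _; rewrite raddf0 rtens0l.
- rewrite {1}et {1}eu -sumrB; apply: eq_bigr => i _.
  by rewrite raddfB rtensBl.
rewrite -/(rtens a p) {1}[p]dual rtens_sumr; apply: eq_bigr => i _.
by rewrite contract_tens rtens_balanced.
Qed.

(** A finitely generated projective bimodule is flat.  The coordinates of a tensor
killed by [g] are killed by [g], so they lift along [f] one at a time, and the
lifts reassemble into a tensor. *)
Lemma rtensor_exact (L G : pzRingType) (N : bimodType L G)
    (A B C : lmodType L^c) :
  fgprojective N -> short_exact A B C ->
  short_exact (rtensor A N) (rtensor B N) (rtensor C N).
Proof.
move=> /dual_basis[n [x [phi dual]]] [f [g [fI gS ex]]].
have expand := contract_expand dual.
exists (rtensor_map f), (rtensor_map g); split.
- apply: raddf_inj => t ft0; rewrite [t]expand big1 // => i _.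
  have -> : contract (phi i) t = 0.
    by apply: fI; rewrite raddf0 -contract_natural ft0 raddf0.
  exact: rtens0l.
- apply: tensor_ind => [|t u [t' <-] [u' <-]|c p].
  + by exists 0; rewrite raddf0.
  + by exists (t' - u'); rewrite raddfB.
  + by have [b <-] := gS c; exists (rtens b p); exact: rtensor_map_tens.
move=> t; split=> [gt0|[s <-]].
  have /fin_all_exists[a fa] i : exists a, f a = contract (phi i) t.
    by apply/ex; rewrite -contract_natural gt0 raddf0.
  exists (\sum_i rtens (a i) (x i)); rewrite [RHS]expand raddf_sum.
  by apply: eq_bigr => i _; rewrite [LHS]rtensor_map_tens fa.
apply: (rtensor_ext (g := rtensor_map g \o rtensor_map f) (h := \0)) => a p /=.
rewrite !rtensor_map_tens.
have -> : g (f a) = 0 by apply/ex; exists a.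
exact: rtens0l.
Qed.

(** * The tensor functor and the extension filtration *)

Section TensorFunctor.
Variables (L G : pzRingType) (N : bimodType L G).

Lemma rtensor_retract (A B : lmodType L^c) :
  retract A B -> retract (rtensor A N) (rtensor B N).
Proof.
move=> [i [r ir]]; exists (rtensor_map i), (rtensor_map r).
apply: (rtensor_ext (g := rtensor_map r \o rtensor_map i) (h := idfun)) => a n /=.
by rewrite !rtensor_map_tens ir.
Qed.

Lemma rtensor_dsum (A B : lmodType L^c) :
  retract (rtensor (dsum A B) N) (dsum (rtensor A N) (rtensor B N)).
Proof.
pose F (A' : lmodType L^c) : lmodType G^c := rtensor A' N.
pose F1 : {linear F (dsum A B) -> F A} := rtensor_map (@dfst _ A B).
pose F2 : {linear F (dsum A B) -> F B} := rtensor_map (@dsnd _ A B).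
pose I1 : {linear F A -> F (dsum A B)} := rtensor_map (@dinl _ A B).
pose I2 : {linear F B -> F (dsum A B)} := rtensor_map (@dinr _ A B).
pose p : {linear F (dsum A B) -> dsum (F A) (F B)} := dpair F1 F2.
pose q : {linear dsum (F A) (F B) -> F (dsum A B)} := dcopair I1 I2.
exists p, q; apply: (rtensor_ext (g := q \o p) (h := idfun)) => s n.
rewrite /= /q /p /dcopair /dpair /= !rtensor_map_tens -[LHS]tensDl.
by rewrite dsumE.
Qed.

Lemma rtensor_zero (S : lmodType G^c) : retract (rtensor (zero_mod L^c) N) S.
Proof.
exists \0, \0; apply: (rtensor_ext (g := \0) (h := idfun)) => a n /=.
have -> : a = 0 by apply/matrixP => i [].
by rewrite rtens0l.
Qed.

(** Additivity of the functor, in the form that composes with a retraction placing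
an object in an additive closure. *)
Lemma rtensor_bigdsum n (X : 'I_n -> lmodType L^c) :
  retract (rtensor (\big[@dsum _/zero_mod _]_(i < n) X i) N)
    (\big[@dsum _/zero_mod _]_(i < n) (rtensor (X i) N : lmodType G^c)).
Proof.
elim: n X => [|n IH] X; first by rewrite !big_ord0; exact: rtensor_zero.
rewrite !big_ord_recl; apply: retract_trans (rtensor_dsum _ _) _.
by apply: retract_dsum (IH _); exists idfun, idfun.
Qed.

Hypothesis fgN : fingen (rmod N).

Definition fgtensor (A : fgmod L^c) : fgmod G^c :=
  FGMod (fingen_rtensor (fgmodP A) fgN).

Lemma fgtensor_add_class (U : mod_class L^c) (V : mod_class G^c) :
  (forall A, U A -> V (fgtensor A)) ->
  forall A, add_class U A -> add_class V (fgtensor A).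
Proof.
move=> UV A /add_classP[n [X [UX rA]]]; apply/add_classP.
exists n, (fgtensor \o X); split=> [i|]; first exact: UV.
exact: retract_trans (rtensor_retract rA) (rtensor_bigdsum X).
Qed.

Hypothesis projN : fgprojective N.

Lemma fgtensor_angle (T : fgmod L^c) n (A : fgmod L^c) :
  angle T n.+1 A -> angle (fgtensor T) n.+1 (fgtensor A).
Proof.
elim: n A => [|n IH] A; first by apply: fgtensor_add_class => B ->.
apply: fgtensor_add_class => B [X1 [X2 [addX1 angX2 ex]]].
exists (fgtensor X1), (fgtensor X2); split; last exact: rtensor_exact.
  by apply: fgtensor_add_class addX1 => C ->.
exact: IH.
Qed.
End TensorFunctor.

(** * Modules are retracts of their double tensor products *)

Lemma btensor_ext (A B C : pzRingType) (M : bimodType A B) (N : bimodType B C)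
    (T : zmodType) (g h : {additive btensor M N -> T}) :
  (forall m n, g (btens m n) = h (btens m n)) -> g =1 h.
Proof. by apply: btensor_eq; exact: raddfB. Qed.

(** The data [p], [e] is what remains of a splitting of [G] off [M (x) N]: a
bimodule map to [G] and the image of [1], which commutes with [G].  A module [B]
then embeds in [(B (x) M) (x) N] by [b |-> b (x) e] and [p] retracts it by
[(b (x) m) (x) n |-> b . p (m (x) n)], because [b . p e = b]. *)
Section SeparableRetract.
Variables (L G : pzRingType) (M : bimodType G L) (N : bimodType L G).
Variables (p : {linear btensor M N -> G^o}) (e : btensor M N).
Hypothesis pr : forall t c, p (ract t c) = (p t : G) * c.
Hypothesis pe : p e = 1.
Hypothesis ce : forall c : G, c *: e = ract e c.
Variable B : lmodType G^c.

(** The retraction with its last argument fixed; it is first lifted from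
[B * M], then from [(B (x) M) * N]. *)
Definition eval_at (n : N) : rtensor B M -> B :=
  tensor_lift (fun (b : B) (m : M) => (p (btens m n) : G^c) *: b).

Let cDl n (b b' : B) m : (p (btens m n) : G^c) *: (b + b') =
  (p (btens m n) : G^c) *: b + (p (btens m n) : G^c) *: b'.
Proof. exact: scalerDr. Qed.
Let cDr n (b : B) m m' : (p (btens (m + m') n) : G^c) *: b =
  (p (btens m n) : G^c) *: b + (p (btens m' n) : G^c) *: b.
Proof.
have -> : btens (m + m') n = btens m n + btens m' n by exact: tensDl.
by rewrite raddfD -scalerDl.
Qed.
Let cZ n (b : B) (c : G) m : (p (btens m n) : G^c) *: ((c : G^c) *: b) =
  (p (btens (c *: m) n) : G^c) *: b.
Proof. by rewrite scalerA -btensZ linearZ. Qed.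

Lemma eval_at_tens n b m :
  eval_at n (rtens b m) = (p (btens m n) : G^c) *: b.
Proof. exact: (tensor_lift_tens (cDl n) (cDr n) (cZ n)). Qed.

Fact eval_at_zmod_morphism n : zmod_morphism (eval_at n).
Proof. exact: (tensor_lift_zmod_morphism (cDl n) (cDr n) (cZ n)). Qed.
HB.instance Definition _ n :=
  GRing.isZmodMorphism.Build (rtensor B M) B (eval_at n)
    (eval_at_zmod_morphism n).

Definition eval : rtensor (rtensor B M) N -> B :=
  tensor_lift (fun (u : rtensor B M) n => eval_at n u).

Let uDl (u u' : rtensor B M) n :
  eval_at n (u + u') = eval_at n u + eval_at n u'.
Proof. exact: raddfD. Qed.
Let uDr (u : rtensor B M) n n' :
  eval_at (n + n') u = eval_at n u + eval_at n' u.
Proof.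
apply: (rtensor_ext (g := eval_at (n + n'))
  (h := eval_at n \+ eval_at n')) => b m /=.
have e' : btens m (n + n') = btens m n + btens m n' by exact: tensDr.
by rewrite !eval_at_tens e' raddfD -scalerDl.
Qed.
Let uZ (u : rtensor B M) (l : L) n :
  eval_at n ((l : L^c) *: u) = eval_at (l *: n) u.
Proof.
apply: (rtensor_ext (g := eval_at n \o *:%R (l : L^c))
  (h := eval_at (l *: n))) => b m /=.
have e' : btens (ract m l) n = btens m (l *: n) by exact: tensZ.
by rewrite rtensZ !eval_at_tens e'.
Qed.

Lemma eval_tens u n : eval (rtens u n) = eval_at n u.
Proof. exact: (tensor_lift_tens uDl uDr uZ). Qed.

Fact eval_zmod_morphism : zmod_morphism eval.
Proof. exact: (tensor_lift_zmod_morphism uDl uDr uZ). Qed.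
HB.instance Definition _ :=
  GRing.isZmodMorphism.Build (rtensor (rtensor B M) N) B eval
    eval_zmod_morphism.

Fact eval_scalable : scalable eval.
Proof.
move=> c.
apply: (rtensor_ext (g := eval \o *:%R c) (h := *:%R c \o eval)) => u n /=.
rewrite rtensZ !eval_tens.
apply: (rtensor_ext (g := eval_at (ract n c))
  (h := *:%R c \o eval_at n)) => b m /=.
by rewrite !eval_at_tens scalerA -btens_ract pr.
Qed.
HB.instance Definition _ :=
  GRing.isScalable.Build G^c (rtensor (rtensor B M) N) B *:%R eval
    eval_scalable.

(** The map [m (x) n |-> (b (x) m) (x) n], one direction of the associativity of
the tensor product for fixed [b]. *)
Definition insert (b : B) : btensor M N -> rtensor (rtensor B M) N :=
  tensor_lift (fun (m : rmod M) n => rtens (rtens b (m : M)) n).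

Let iDl (b : B) (m m' : rmod M) (n : N) :
  rtens (rtens b (m + m' : M)) n =
  rtens (rtens b (m : M)) n + rtens (rtens b (m' : M)) n.
Proof. by rewrite raddfD -[RHS]tensDl. Qed.
Let iDr (b : B) (m : rmod M) (n n' : N) :
  rtens (rtens b (m : M)) (n + n') =
  rtens (rtens b (m : M)) n + rtens (rtens b (m : M)) n'.
Proof. exact: raddfD. Qed.
Let iZ (b : B) (m : rmod M) (l : L) (n : N) :
  rtens (rtens b ((l : L^c) *: m : M)) n = rtens (rtens b (m : M)) (l *: n).
Proof. by rewrite -rtens_balanced rtensZ. Qed.

Lemma insert_tens (b : B) (m : M) (n : N) :
  insert b (btens m n) = rtens (rtens b m) n.
Proof. exact: (tensor_lift_tens (iDl b) (iDr b) (iZ b)). Qed.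

Fact insert_zmod_morphism b : zmod_morphism (insert b).
Proof. exact: (tensor_lift_zmod_morphism (iDl b) (iDr b) (iZ b)). Qed.
HB.instance Definition _ b :=
  GRing.isZmodMorphism.Build (btensor M N) (rtensor (rtensor B M) N) (insert b)
    (insert_zmod_morphism b).

Lemma insertD b b' t : insert (b + b') t = insert b t + insert b' t.
Proof.
apply: (btensor_ext (g := insert (b + b')) (h := insert b \+ insert b')).
by move=> m n /=; rewrite !insert_tens -[RHS]tensDl -[rtens _ _ + _]tensDl.
Qed.

Lemma insertZ (c : G) b t : insert ((c : G^c) *: b) t = insert b (c *: t).
Proof.
apply: (btensor_ext (g := insert ((c : G^c) *: b)) (h := insert b \o *:%R c)).
by move=> m n /=; rewrite btensZ !insert_tens rtens_balanced.
Qed.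

Lemma insert_ract (c : G) b t : insert b (ract t c) = (c : G^c) *: insert b t.
Proof.
apply: (btensor_ext (g := insert b \o ract_by c)
  (h := *:%R (c : G^c) \o insert b)) => m n /=.
by rewrite /ract_by btens_ract !insert_tens rtensZ.
Qed.

Lemma eval_insert b t : eval (insert b t) = (p t : G^c) *: b.
Proof.
apply: (btensor_eq (g := eval \o insert b) (h := fun t => (p t : G^c) *: b)).
- exact: raddfB.
- by move=> u v; rewrite raddfB scalerBl.
by move=> m n /=; rewrite insert_tens eval_tens eval_at_tens.
Qed.

Definition coeval (b : B) : rtensor (rtensor B M) N := insert b e.
(** Linearity is where [e] has to commute with [G]:
[bc (x) e = b (x) ce = b (x) ec = (b (x) e)c]. *)
Fact coeval_linear : linear coeval.
Proof.
move=> c a b; rewrite /coeval insertD; congr (_ + _).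
by rewrite -insert_ract -ce -insertZ.
Qed.
HB.instance Definition _ :=
  GRing.isLinear.Build G^c B (rtensor (rtensor B M) N) *:%R coeval
    coeval_linear.

Lemma central_retract : retract B (rtensor (rtensor B M) N).
Proof.
exists coeval, eval => b.
by rewrite [LHS]eval_insert pe; exact: scale1r.
Qed.
End SeparableRetract.

(** The element [e] is the preimage of [(1, 0)]; it commutes with [G] since [1] does
in the regular bimodule. *)
Lemma separable_retract (L G : pzRingType) (M : bimodType G L)
    (N : bimodType L G) (X : bimodType G G) (B : lmodType G^c) :
  bimod_iso (btensor M N) (bdsum G^o X) -> retract B (rtensor (rtensor B M) N).
Proof.
move=> [f [/linear_inverse[g [fK gK]] fr]].
pose p : {linear btensor M N -> G^o} := @dfst G G^o X \o f.
apply: (@central_retract L G M N p (g (1, 0))) => [t c||c].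
- by rewrite /p /= fr.
- by rewrite /p /= gK.
apply: (can_inj fK); rewrite linearZ fr !gK; congr pair => /=.
  exact: etrans (mulr1 c) (esym (mul1r c)).
(* In the second coordinate, ract 0 c = 0. *)
rewrite scaler0; apply: (addrI (ract (0 : X) c)).
by rewrite -ractDl !addr0.
Qed.

(** * Invariance of the extension dimension *)

(** The image of the generator of [mod L] generates [mod G] in the same number of
extensions, because every [B] is a retract of an object in the image. *)
Lemma ext_dim_le_transfer (L G : pzRingType) (M : bimodType G L)
    (N : bimodType L G) (X : bimodType G G) n :
  fingen (rmod M) -> fingen (rmod N) -> fgprojective N ->
  bimod_iso (btensor M N) (bdsum G^o X) ->
  ext_dim_le L^c n -> ext_dim_le G^c n.
Proof.
move=> fgM fgN projN iso [T TP]; exists (fgtensor fgN T) => B.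
apply: (@angle_retract _ _ _ _ (fgtensor fgN (fgtensor fgM B))).
  exact: separable_retract iso.
exact: fgtensor_angle.
Qed.

Lemma ext_dim_eq (R S : pzRingType) :
  (forall n, ext_dim_le R n <-> ext_dim_le S n) -> ext_dim R = ext_dim S.
Proof.
move=> RS; rewrite /ext_dim.
case: pselect => [exR|nR]; case: pselect => [exS|nS] //.
- congr (_%:E); apply: eq_ex_minn => n; exact/asbool_equiv_eq/RS.
- by case: nS; case: exR => n /asboolP/RS Sn; exists n; apply/asboolP.
- by case: nR; case: exS => n /asboolP/RS Sn; exists n; apply/asboolP.
Qed.

Theorem theorem4p5 (Lambda Gamma : pzRingType)
    (artin_Lambda : artin_algebra Lambda) (artin_Gamma : artin_algebra Gamma)
    (sep_eq : separably_equivalent Lambda Gamma) :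
  dim_mod Lambda = dim_mod Gamma.
Proof.
have [M [N [[projM [fgM _] projN [fgN _]] [X isoX] [Y isoY]]]] := sep_eq.
apply: ext_dim_eq => n; split.
  exact: ext_dim_le_transfer isoX.
exact: ext_dim_le_transfer isoY.
Qed.
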